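(* Let $\Lambda_{TT}=\{(F(x),\Lambda_x,v(x))\}_{x\in X}$ be a continuous $(T,T)$-controlled $g$-fusion Bessel family in $H$ with bound $B$. If $\{v^2(x)\,T^*P_{F(x)}\Lambda_x^*\Lambda_xP_{F(x)}U\}_{x\in X}$ is a continuous resolution of the identity operator on $H$, then $\Lambda_{TT}$ (that is, the family $\{(F(x),\Lambda_x,v(x))\}_{x\in X}$) is a continuous $(U,U)$-controlled $g$-fusion frame for $H$.
   Context: $H$ is a separable Hilbert space, $\mathbb H$ is the collection of all closed subspaces of $H$, and $(X,\mu)$ is a measure space with positive measure $\mu$; $d\mu_x$ denotes integration with respect to $\mu$ in the variable $x$. $P_M$ is the orthogonal projection of $H$ onto a closed subspace $M$ (when followed by an operator defined on $M$ it is regarded as a map $H\to M$; its adjoint is then the inclusion $M\to H$). An operator is positive if it is self-adjoint and $\langle Sf,f\rangle\ge 0$ for all $f$; $\mathcal{GB}^+(H)$ is the set of positive bounded operators on $H$ with bounded inverse. Here $T,U\in\mathcal{GB}^+(H)$, $F:X\to\mathbb H$ is a mapping, $v:X\to\mathbb R^+$ is measurable, $\{K_x\}_{x\in X}$ are Hilbert spaces, and $\Lambda_x:F(x)\to K_x$ is bounded linear for each $x\in X$. Definition. For $R,S\in\mathcal{GB}^+(H)$, the family $\{(F(x),\Lambda_x,v(x))\}_{x\in X}$ is a continuous $(R,S)$-controlled $g$-fusion frame for $H$ if (i) for each $f\in H$ the mapping $x\mapsto P_{F(x)}f$ is measurable, and (ii) there are constants $0<A\le B<\infty$ (bounds) such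 that for all $f\in H$ $$A\|f\|^2\le\int_X v^2(x)\langle\Lambda_xP_{F(x)}Sf,\Lambda_xP_{F(x)}Rf\rangle\,d\mu_x\le B\|f\|^2 .$$ If (i) and the right-hand inequality in (ii) hold, it is a continuous $(R,S)$-controlled $g$-fusion Bessel family with bound $B$. A family $\{R_x\}_{x\in X}$ of bounded operators on $H$ is a continuous resolution of the identity operator on $H$ if for all $f,g\in H$ the function $x\mapsto\langle R_xf,g\rangle$ is measurable on $X$ and $\langle f,g\rangle=\int_X\langle R_xf,g\rangle\,d\mu_x$. *)

(* Defs.v *)
From HB Require Import structures.
From mathcomp Require Import all_boot all_order all_algebra sesquilinear.
From mathcomp Require Import all_classical all_reals all_analysis.
From mathcomp Require Import complex.

Set Implicit Arguments.
Unset Strict Implicit.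
Unset Printing Implicit Defensive.

Import Order.TTheory GRing.Theory Num.Theory.
Import numFieldNormedType.Exports.

Local Open Scope classical_set_scope.
Local Open Scope ring_scope.

(* Hilbert spaces are taken over the real or over the complex scalars. *)
Variant scalar_kind := RealScalars | ComplexScalars.

Section Scalars.
Variable R : realType.

Definition scalars (k : scalar_kind) : numFieldType :=
  match k with RealScalars => R : numFieldType | ComplexScalars => R[i] end.

Definition scalar_conj (k : scalar_kind) : involutive_rmorphism (scalars k) :=
  match k with
  | RealScalars => idfun : involutive_rmorphism R
  | ComplexScalars => Num.conj : involutive_rmorphism R[i]
  end.

Definition scalar_re (k : scalar_kind) : scalars k -> R :=
  match k with
  | RealScalars => fun z => z
  | ComplexScalars => fun z : R[i] => complex.Re z
  end.

Definition scalar_im (k : scalar_kind) : scalars k -> R :=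
  match k with
  | RealScalars => fun=> 0
  | ComplexScalars => fun z : R[i] => complex.Im z
  end.

Definition mk_scalar (k : scalar_kind) : R -> R -> scalars k :=
  match k with
  | RealScalars => fun a _ => a
  | ComplexScalars => fun a b => (a +i* b)%C : R[i]
  end.

Definition real_scalar (k : scalar_kind) (a : R) : scalars k :=
  mk_scalar k a 0.

End Scalars.

HB.mixin Record isHilbert (R : realType) (k : scalar_kind) H
    of CompleteNormedModule (scalars R k) H := {
  inner : {dot H for scalar_conj R k};
  inner_norm : forall x : H, inner x x = `|x| ^+ 2
}.

#[short(type="hilbertType")]
HB.structure Definition Hilbert (R : realType) (k : scalar_kind) :=
  {H of isHilbert R k H & CompleteNormedModule (scalars R k) H}.

Arguments real_scalar {R k} a.

(* A scalar-valued function is integrated through its real and imaginary parts,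
   which the library integrates as real-valued functions. *)
Section ScalarIntegral.
Variables (R : realType) (k : scalar_kind).
Variables (d : measure_display) (X : measurableType d).
Variable mu : {measure set X -> \bar R}.

(* [mu.-integrable] includes measurability. *)
Definition scalar_integrable (h : X -> scalars R k) : Prop :=
  mu.-integrable setT (fun x => (scalar_re (h x))%:E) /\
  mu.-integrable setT (fun x => (scalar_im (h x))%:E).

(* Only meaningful for [h] integrable. *)
Definition scalar_integral (h : X -> scalars R k) : scalars R k :=
  mk_scalar k (Rintegral mu setT (fun x => scalar_re (h x)))
              (Rintegral mu setT (fun x => scalar_im (h x))).

End ScalarIntegral.

Section Operators.
Variables (R : realType) (k : scalar_kind).

Definition separable_space (H : hilbertType R k) : Prop :=
  exists2 D : set H, countable D & dense D.

Record closedSubspace (H : hilbertType R k) := ClosedSubspace {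
  subspace_set :> set H;
  subspace0 : subspace_set 0;
  subspace_lin : forall (a : scalars R k) (x y : H),
    subspace_set x -> subspace_set y -> subspace_set (a *: x + y);
  subspace_closed : closed subspace_set
}.

(* An operator defined on a subspace [M] of [H] is given by a map on [H] of
   which only the values on [M] are used. *)
Definition bounded_linear_on (H K : hilbertType R k) (M : set H) (A : H -> K) :
    Prop :=
  (forall (a : scalars R k) (x y : H),
     M x -> M y -> A (a *: x + y) = a *: A x + A y) /\
  exists C : R, forall x, M x -> `|A x| <= real_scalar C * `|x|.

Definition bounded_operator (H K : hilbertType R k) (A : H -> K) : Prop :=
  bounded_linear_on setT A.

(* The point of [M] such that [f - orth_proj M f] is orthogonal to [M]; it
   exists and is unique when [M] is a closed subspace. *)
Definition orth_proj (H : hilbertType R k) (M : set H) (f : H) : H :=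
  xget 0 [set p | M p /\ forall m, M m -> inner (f - p) m = 0].

(* The adjoint, with values in [M], of an operator [A] defined on [M]; it exists
   and is unique when [M] is a closed subspace and [A] is bounded on [M]. *)
Definition adjoint_on (H K : hilbertType R k) (M : set H) (A : H -> K) (y : K) :
    H :=
  xget 0 [set m | M m /\ forall f, M f -> inner (A f) y = inner f m].

Definition adjoint (H K : hilbertType R k) (A : H -> K) : K -> H :=
  adjoint_on setT A.

Definition self_adjoint (H : hilbertType R k) (A : H -> H) : Prop :=
  forall f g : H, inner (A f) g = inner f (A g).

(* Over complex scalars, [0 <= z] says that [z] is real and nonnegative. *)
Definition positive_operator (H : hilbertType R k) (A : H -> H) : Prop :=
  self_adjoint A /\ forall f : H, 0 <= inner (A f) f.

Definition GBplus (H : hilbertType R k) (A : H -> H) : Prop :=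
  [/\ bounded_operator A, positive_operator A &
      exists A' : H -> H, [/\ bounded_operator A', cancel A A' & cancel A' A]].

End Operators.

Section Frames.
Variables (R : realType) (k : scalar_kind).
Variables (d : measure_display) (X : measurableType d).
Variable mu : {measure set X -> \bar R}.
Variable H : hilbertType R k.

(* Measurability of an [H]-valued map is with respect to the Borel sets of
   [H]; when [H] is separable, weak measurability is equivalent. *)
Definition vector_measurable (h : X -> H) : Prop :=
  measurable_fun setT (h : X -> g_sigma_algebraType (@open H)).

Section Controlled.
Variable K : X -> hilbertType R k.
Variables (F : X -> closedSubspace H) (L : forall x, H -> K x) (v : X -> R).

Definition controlled_integrand (Rop Sop : H -> H) (f : H) (x : X) :
    scalars R k :=
  real_scalar (v x ^+ 2) *
    inner (L x (orth_proj (F x) (Sop f))) (L x (orth_proj (F x) (Rop f))).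

Definition controlled_gfusion_Bessel (Rop Sop : H -> H) (B : R) : Prop :=
  [/\ forall f, vector_measurable (fun x => orth_proj (F x) f),
      0 < B &
      forall f, scalar_integrable mu (controlled_integrand Rop Sop f) /\
        scalar_integral mu (controlled_integrand Rop Sop f)
          <= real_scalar B * `|f| ^+ 2].

Definition controlled_gfusion_frame (Rop Sop : H -> H) : Prop :=
  (forall f, vector_measurable (fun x => orth_proj (F x) f)) /\
  exists A B : R, [/\ 0 < A, A <= B &
    forall f, scalar_integrable mu (controlled_integrand Rop Sop f) /\
      real_scalar A * `|f| ^+ 2
        <= scalar_integral mu (controlled_integrand Rop Sop f)
        <= real_scalar B * `|f| ^+ 2].

End Controlled.

Definition resolution_of_identity (Rx : X -> H -> H) : Prop :=
  (forall x, bounded_operator (Rx x)) /\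
  forall f g : H, scalar_integrable mu (fun x => inner (Rx x f) g) /\
    inner f g = scalar_integral mu (fun x => inner (Rx x f) g).

End Frames.

(* Main.v *)
Require Import Defs.
From HB Require Import structures.
From mathcomp Require Import all_boot all_order all_algebra sesquilinear.
From mathcomp Require Import all_classical all_reals all_analysis.
From mathcomp Require Import complex.
From mathcomp Require Import ring lra.

(** Write [a f x] and [b f x] for the vectors obtained by applying
    [L x \o orth_proj (F x)] to [T f] and to [U f].

    Upper bound: [T] is invertible, so [b f = a (T^-1 (U f))], and the Bessel
    inequality at [T^-1 (U f)] bounds the [U]-energy of [f] by
    [B * |T^-1|^2 * |U|^2 * |f|^2].  The same substitution gives integrability.

    Lower bound: since [T] is self-adjoint, the operators [R_x] of the
    resolution satisfy [<R_x f, f> = v^2 <b f x, a f x>], which by Young's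
    inequality with parameter [B] gives
    [2 Re <R_x f, f> <= B v^2 |b f x|^2 + B^-1 v^2 |a f x|^2].
    Integrating, the left side becomes [2 |f|^2] and the Bessel bound makes the
    last term at most [|f|^2]; hence [|f|^2 <= B * energy (U f)], so [B^-1] is
    a lower frame bound ([norm_le_energy]).

    Identifying [<R_x f, f>] requires that [orth_proj (F x)] really be the
    orthogonal projection.  This is the projection theorem ([orth_projP]),
    proved by the classical minimizing-sequence argument in the complete
    space [H]. *)

Set Implicit Arguments.
Unset Strict Implicit.
Unset Printing Implicit Defensive.

Import Order.TTheory GRing.Theory Num.Theory.
Import numFieldNormedType.Exports.

Local Open Scope classical_set_scope.
Local Open Scope ring_scope.

(** * Real parts and real scalars *)

Section ScalarTheory.
Variables (R : realType) (k : scalar_kind).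
Implicit Types (z w : scalars R k) (a b : R).

Lemma scalar_re0 : scalar_re (0 : scalars R k) = 0.
Proof. by case: k. Qed.

Lemma scalar_reD z w : scalar_re (z + w) = scalar_re z + scalar_re w.
Proof. by case: k z w => // -[? ?] [? ?]. Qed.

Lemma scalar_reN z : scalar_re (- z) = - scalar_re z.
Proof. by case: k z => // -[? ?]. Qed.

Lemma scalar_reB z w : scalar_re (z - w) = scalar_re z - scalar_re w.
Proof. by rewrite scalar_reD scalar_reN. Qed.

Lemma scalar_re_conj z : scalar_re (scalar_conj R k z) = scalar_re z.
Proof. by case: k z => // -[? ?]. Qed.

Lemma scalar_re_real a : scalar_re (real_scalar a : scalars R k) = a.
Proof. by case: k. Qed.

Lemma scalar_re_mk a b : scalar_re (mk_scalar k a b) = a.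
Proof. by case: k. Qed.

Lemma scalar_im_real a : scalar_im (real_scalar a : scalars R k) = 0.
Proof. by case: k. Qed.

Lemma real_scalar0 : real_scalar 0 = 0 :> scalars R k.
Proof. by case: k. Qed.

Lemma real_scalar1 : real_scalar 1 = 1 :> scalars R k.
Proof. by case: k. Qed.

Lemma real_scalarD a b :
  real_scalar (a + b) = real_scalar a + real_scalar b :> scalars R k.
Proof. by case: k => //=; rewrite /real_scalar /=; simpc. Qed.

Lemma real_scalarM a b :
  real_scalar (a * b) = real_scalar a * real_scalar b :> scalars R k.
Proof. by case: k => //=; rewrite /real_scalar /=; simpc. Qed.

Lemma scalar_conj_real a :
  scalar_conj R k (real_scalar a) = real_scalar a.
Proof. by case: k => //=; apply/eqP; rewrite eq_complex /= oppr0 !eqxx. Qed.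

Lemma scalar_reZ a z : scalar_re (real_scalar a * z) = a * scalar_re z.
Proof. by case: k z => // -[? ?] /=; rewrite mul0r subr0. Qed.

Lemma ler_real_scalar a b :
  (real_scalar a <= real_scalar b :> scalars R k) = (a <= b).
Proof. by case: k => //=; rewrite /real_scalar /= lecE /= eqxx. Qed.

Lemma ltr_real_scalar a b :
  (real_scalar a < real_scalar b :> scalars R k) = (a < b).
Proof. by case: k => //=; rewrite /real_scalar /= ltcE /= eqxx. Qed.

Lemma ge0_scalarE z : 0 <= z -> z = real_scalar (scalar_re z).
Proof.
case: k z => //= -[a b]; rewrite lecE /= => /andP[/eqP b0 _].
by rewrite /real_scalar /= b0.
Qed.

Lemma scalar_re_ge0 z : 0 <= z -> 0 <= scalar_re z.
Proof. by move=> z0; rewrite -ler_real_scalar real_scalar0 -ge0_scalarE. Qed.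

Lemma scalar_conjM_re z :
  z * scalar_conj R k z = real_scalar (scalar_re (z * scalar_conj R k z)).
Proof.
case: k z => //= -[a b]; rewrite /real_scalar /=; simpc.
by congr (_ +i* _)%C; ring.
Qed.

Lemma scalar_conjM_re_ge0 z : 0 <= scalar_re (z * scalar_conj R k z).
Proof.
case: k z => [z|[a b]] /=; first by rewrite -expr2 sqr_ge0.
by rewrite mulrN opprK -!expr2 addr_ge0 // sqr_ge0.
Qed.

Lemma scalar_conjM_re_le0 z : scalar_re (z * scalar_conj R k z) <= 0 -> z = 0.
Proof.
move=> z0; have {}z0 : z * scalar_conj R k z = 0.
  rewrite scalar_conjM_re -real_scalar0; congr real_scalar.
  by apply/eqP; rewrite eq_le z0 scalar_conjM_re_ge0.
move/eqP: z0; rewrite mulf_eq0 => /orP[/eqP//|].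
by rewrite fmorph_eq0 => /eqP.
Qed.

End ScalarTheory.

(** * Real-valued norm and inner product *)

Section RealNorm.
Variables (R : realType) (k : scalar_kind) (H : hilbertType R k).
Implicit Types x y z : H.

(** The norm of [H] takes its values in the scalar field, which is only
    partially ordered when complex; infima and [nra] need a real number. *)
Definition rnorm x : R := scalar_re `|x|.

Lemma normE x : `|x| = real_scalar (rnorm x) :> scalars R k.
Proof. exact/ge0_scalarE/normr_ge0. Qed.

Lemma rnorm_ge0 x : 0 <= rnorm x.
Proof. exact/scalar_re_ge0/normr_ge0. Qed.

Lemma innerxx x : inner x x = real_scalar (rnorm x ^+ 2) :> scalars R k.
Proof. by rewrite inner_norm normE !expr2 real_scalarM. Qed.

Lemma ler_rnormD x y : rnorm (x + y) <= rnorm x + rnorm y.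
Proof.
by rewrite -(ler_real_scalar k) real_scalarD -!normE ler_normD.
Qed.

Lemma innerC x y : inner x y = scalar_conj R k (inner y x).
Proof. by rewrite (hermC (@inner R k H)) expr0 mul1r. Qed.

Lemma innerDl x y z : inner (x + y) z = inner x z + inner y z.
Proof. exact: linearDl. Qed.
Lemma innerDr x y z : inner z (x + y) = inner z x + inner z y.
Proof. exact: linearDr. Qed.
Lemma innerBl x y z : inner (x - y) z = inner x z - inner y z.
Proof. exact: linearBl. Qed.
Lemma innerBr x y z : inner z (x - y) = inner z x - inner z y.
Proof. exact: linearBr. Qed.
Lemma inner0l z : inner 0 z = 0.
Proof. exact: linear0l. Qed.
Lemma innerZl (a : scalars R k) x z : inner (a *: x) z = a * inner x z.
Proof. exact: linearZl_LR. Qed.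
Lemma innerZr (a : scalars R k) x z :
  inner x (a *: z) = scalar_conj R k a * inner x z.
Proof. exact: linearZr_LR. Qed.

Lemma re_innerC x y : scalar_re (inner x y) = scalar_re (inner y x).
Proof. by rewrite innerC scalar_re_conj. Qed.

Lemma rnormB_sqr x y :
  rnorm (x - y) ^+ 2 = rnorm x ^+ 2 - 2 * scalar_re (inner x y) + rnorm y ^+ 2.
Proof.
rewrite -(scalar_re_real k (rnorm (x - y) ^+ 2)) -innerxx.
rewrite innerBl !innerBr !scalar_reB (re_innerC y x) !innerxx !scalar_re_real.
by ring.
Qed.

Lemma rnormD_sqr x y :
  rnorm (x + y) ^+ 2 = rnorm x ^+ 2 + 2 * scalar_re (inner x y) + rnorm y ^+ 2.
Proof.
rewrite -(scalar_re_real k (rnorm (x + y) ^+ 2)) -innerxx.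
rewrite innerDl !innerDr !scalar_reD (re_innerC y x) !innerxx !scalar_re_real.
by ring.
Qed.

Lemma rnormZ_real (a : R) x :
  rnorm (real_scalar a *: x) ^+ 2 = a ^+ 2 * rnorm x ^+ 2.
Proof.
rewrite -(scalar_re_real k (rnorm _ ^+ 2)) -innerxx innerZl innerZr.
by rewrite scalar_conj_real innerxx -!real_scalarM scalar_re_real mulrA -expr2.
Qed.

(** Expand [0 <= |t x - y|^2] and divide by [t]. *)
Lemma inner_young (t : R) x y : 0 < t ->
  2 * scalar_re (inner x y) <= t * rnorm x ^+ 2 + t^-1 * rnorm y ^+ 2.
Proof.
move=> t0; have := sqr_ge0 (rnorm (real_scalar t *: x - y)).
rewrite rnormB_sqr rnormZ_real innerZl scalar_reZ => h.
have {h} : 0 <= t^-1 * (t ^+ 2 * rnorm x ^+ 2 -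
   2 * (t * scalar_re (inner x y)) + rnorm y ^+ 2).
  by rewrite mulr_ge0 // invr_ge0 ltW.
have -> : t^-1 * (t ^+ 2 * rnorm x ^+ 2 -
   2 * (t * scalar_re (inner x y)) + rnorm y ^+ 2) =
   t * rnorm x ^+ 2 + t^-1 * rnorm y ^+ 2 - 2 * scalar_re (inner x y).
  by field; rewrite gt_eqF.
by rewrite subr_ge0.
Qed.

End RealNorm.

(** * The projection theorem *)

Section Projection.
Variables (R : realType) (k : scalar_kind) (H : hilbertType R k).
Variable M : closedSubspace H.
Implicit Types f m p : H.

Lemma subspaceZ (a : scalars R k) m :
  subspace_set M m -> subspace_set M (a *: m).
Proof. by move=> Mm; rewrite -[_ *: _]addr0; apply/subspace_lin/subspace0. Qed.

Lemma subspaceD m p :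
  subspace_set M m -> subspace_set M p -> subspace_set M (m + p).
Proof. by move=> Mm Mp; rewrite -[m]scale1r; apply: subspace_lin. Qed.

(** Parallelogram law: the midpoint of [m] and [p] lies in [M], hence is at
    distance at least [dl] from [f], so
    [|m - p|^2 <= 4 (dl + e)^2 - 4 dl^2]. *)
Lemma near_minimizers_close f (dl e : R) m p :
    (forall q, subspace_set M q -> dl <= rnorm (f - q)) -> 0 <= dl -> 0 <= e ->
    subspace_set M m -> subspace_set M p ->
    rnorm (f - m) <= dl + e -> rnorm (f - p) <= dl + e ->
  rnorm (m - p) ^+ 2 <= 8 * dl * e + 4 * e ^+ 2.
Proof.
move=> dlP dl0 e0 Mm Mp hm hp.
have mid : dl <= rnorm (f - real_scalar 2^-1 *: (m + p)).
  exact/dlP/subspaceZ/subspaceD.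
have mid2 : (f - m) + (f - p) =
    real_scalar 2 *: (f - real_scalar 2^-1 *: (m + p)).
  rewrite scalerBr scalerA -real_scalarM mulfV// real_scalar1 scale1r.
  rewrite (_ : 2 = 1 + 1 :> R) // real_scalarD real_scalar1 scalerDl scale1r.
  by rewrite opprD addrACA.
have mpE : m - p = (f - p) - (f - m) by rewrite opprB [RHS]addrC addrA subrK.
have := rnormD_sqr (f - m) (f - p); rewrite mid2 rnormZ_real => eD.
have := rnormB_sqr (f - p) (f - m); rewrite -mpE re_innerC => eB.
have sm : rnorm (f - m) ^+ 2 <= (dl + e) ^+ 2.
  by rewrite lerXn2r ?nnegrE ?rnorm_ge0 ?addr_ge0.
have sp : rnorm (f - p) ^+ 2 <= (dl + e) ^+ 2.
  by rewrite lerXn2r ?nnegrE ?rnorm_ge0 ?addr_ge0.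
have sq : dl ^+ 2 <= rnorm (f - real_scalar 2^-1 *: (m + p)) ^+ 2.
  by rewrite lerXn2r ?nnegrE ?rnorm_ge0.
nra.
Qed.

(** By [near_minimizers_close] a sequence in [M] whose distances to [f] tend to
    the infimum is Cauchy; its limit stays in [M] because [M] is closed. *)
Lemma exists_nearest_point f :
  exists2 p, subspace_set M p &
    forall m, subspace_set M m -> rnorm (f - p) <= rnorm (f - m).
Proof.
pose D := [set rnorm (f - m) | m in subspace_set M].
have D0 : has_lbound D by exists 0 => _ [m _ <-]; exact: rnorm_ge0.
have Dn : D !=set0 by exists (rnorm (f - 0)), 0 => //; exact: subspace0.
pose dl := inf D.
have dl0 : 0 <= dl by apply: lb_le_inf => // _ [m _ <-]; exact: rnorm_ge0.
have dlP q : subspace_set M q -> dl <= rnorm (f - q).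
  by move=> Mq; apply: ge_inf => //; exists q.
have /choice[u uP] : forall n : nat,
    exists m, subspace_set M m /\ rnorm (f - m) < dl + n.+1%:R^-1.
  move=> n.
  have n0 : 0 < n.+1%:R^-1 :> R by rewrite invr_gt0.
  by have [_ [m Mm <-] ?] := inf_adherent n0 (conj Dn D0); exists m.
have sm (e : R) : 0 < e ->
    exists2 e', 0 < e' & 8 * dl * e' + 4 * e' ^+ 2 < e ^+ 2.
  (* The witness [e ^+ 2 / c] is at most 1, so its square is at most itself. *)
  move=> e0; have e2 := exprn_gt0 2 e0; pose c := 8 * dl + 4 + e ^+ 2.
  have c0 : 0 < c by rewrite /c; lra.
  have e'0 : 0 < e ^+ 2 / c by rewrite divr_gt0.
  exists (e ^+ 2 / c) => //.
  have e'1 : e ^+ 2 / c <= 1 by rewrite ler_pdivrMr// /c; lra.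
  have : c * (e ^+ 2 / c) = e ^+ 2 by rewrite mulrC divfK// gt_eqF.
  rewrite {1}/c; nra.
have uN (e : R) : 0 < e -> \forall n \near \oo, rnorm (f - u n) <= dl + e.
  move=> e0; near=> n.
  apply: (le_trans (ltW (proj2 (uP n)))); rewrite lerD2l ltW//.
  near: n; exact: near_infty_natSinv_lt (PosNum e0).
have u_cauchy : cauchy (u @ \oo).
  apply/cauchy_ballP => e e0.
  have eE := ge0_scalarE (ltW e0).
  have e1 : 0 < scalar_re e by rewrite -(ltr_real_scalar k) real_scalar0 -eE.
  have [e' e'0 e'P] := sm _ e1.
  have [N _ NP] := uN _ e'0.
  exists ([set u n | n in [set n | (N <= n)%N]],
          [set u n | n in [set n | (N <= n)%N]]) => /=.
    by split; exists N => // n /= ?; exists n.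
  move=> [_ _] [/= [m Nm <-] [n Nn <-]].
  rewrite -ball_normE /= normE eE ltr_real_scalar.
  rewrite -(ltr_pXn2r (n := 2)) ?nnegrE ?rnorm_ge0 ?ltW//.
  apply: le_lt_trans e'P; apply: (near_minimizers_close dlP) => //.
  - exact: ltW.
  - by have [] := uP m.
  - by have [] := uP n.
  - exact: NP.
  - exact: NP.
have [p up] : exists p, u n @[n --> \oo] --> p.
  by apply/cvg_ex; exact: cauchy_cvg.
exists p.
  apply: (closed_cvg (subspace_set M) _ _ _ up); first exact: subspace_closed.
  by apply: nearW => n; have [] := uP n.
move=> m Mm; apply: (le_trans _ (dlP _ Mm)).
apply/ler_addgt0Pl => e e0.
have e20 : 0 < e / 2 by rewrite divr_gt0.
have e2s : 0 < real_scalar (e / 2) :> scalars R k.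
  by rewrite -real_scalar0 ltr_real_scalar.
have [n [hn1 hn2]] : exists n,
    rnorm (f - u n) <= dl + e / 2 /\ rnorm (u n - p) <= e / 2.
  apply: (@filter_ex _ \oo); apply: filterI; first exact: uN.
  have /cvgrPdist_le/(_ _ e2s) := up.
  apply: filterS => n; by rewrite distrC normE ler_real_scalar.
have -> : f - p = (f - u n) + (u n - p) by rewrite addrA subrK.
apply: (le_trans (ler_rnormD _ _)); lra.
Unshelve. all: end_near.
Qed.

(** Let [w] be the inner product of [f - p] and [m].  Moving [p] by
    [(s * w) *: m] changes the squared distance by
    [|w|^2 (s^2 |m|^2 - 2 s)], which is negative for small [s > 0] unless
    [w = 0]. *)
Lemma nearest_point_orth f p m :
    subspace_set M p ->
    (forall q, subspace_set M q -> rnorm (f - p) <= rnorm (f - q)) ->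
  subspace_set M m -> inner (f - p) m = 0.
Proof.
move=> Mp pP Mm.
set w := inner (f - p) m.
pose q := scalar_re (w * scalar_conj R k w).
(* With this [s], [s * rnorm m ^+ 2 = 1 - s < 1]. *)
pose s := (rnorm m ^+ 2 + 1)^-1.
have N0 : 0 <= rnorm m ^+ 2 by rewrite sqr_ge0.
have s0 : 0 < s by rewrite invr_gt0; lra.
have sN : s * (rnorm m ^+ 2 + 1) = 1 by rewrite mulVf// gt_eqF//; lra.
apply: scalar_conjM_re_le0; rewrite -/q.
have q0 : 0 <= q by exact: scalar_conjM_re_ge0.
pose c := real_scalar s * w.
have : rnorm (f - p) <= rnorm ((f - p) - c *: m).
  by rewrite -addrA -opprD; apply/pP/subspaceD/subspaceZ.
rewrite -(ler_pXn2r (n := 2)) ?nnegrE ?rnorm_ge0// (rnormB_sqr (f - p)).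
have -> : rnorm (c *: m) ^+ 2 = s ^+ 2 * q * rnorm m ^+ 2.
  rewrite -(scalar_re_real k (rnorm _ ^+ 2)) -innerxx innerZl innerZr innerxx.
  rewrite /c rmorphM /= scalar_conj_real.
  rewrite (_ : _ * _ = real_scalar (s ^+ 2 * rnorm m ^+ 2) *
      (w * scalar_conj R k w)); last by rewrite expr2 !real_scalarM; ring.
  by rewrite scalar_reZ -/q; ring.
have -> : scalar_re (inner (f - p) (c *: m)) = s * q.
  rewrite innerZr -/w /c rmorphM /= scalar_conj_real -mulrA scalar_reZ.
  by rewrite [_ * w]mulrC.
have -> : s ^+ 2 * q * rnorm m ^+ 2 = s * q * (1 - s) by rewrite -sN; ring.
move=> h; have : s * q <= 0 by have := mulr_ge0 (ltW s0) q0; nra.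
by rewrite pmulr_rle0.
Qed.

Lemma orth_projP f : subspace_set M (orth_proj M f) /\
  forall m, subspace_set M m -> inner (f - orth_proj M f) m = 0.
Proof.
have [p Mp pP] := exists_nearest_point f.
apply: (xgetPex 0 (P := [set p | subspace_set M p /\
  forall m, subspace_set M m -> inner (f - p) m = 0])).
by exists p; split=> // m; exact: nearest_point_orth.
Qed.

Lemma orth_proj_id m : subspace_set M m -> orth_proj M m = m.
Proof.
move=> Mm; have [Mp pP] := orth_projP m.
apply/eqP; rewrite eq_sym -subr_eq0 -normr_eq0 -sqrf_eq0 -inner_norm.
apply/eqP/pP; rewrite -scaleN1r addrC; exact: subspace_lin.
Qed.

End Projection.

(** * Bounded operators and adjoints *)

Section Operators.
Variables (R : realType) (k : scalar_kind).

Lemma bounded_operator_sqr (H K : hilbertType R k) (A : H -> K) :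
    bounded_operator A ->
  exists2 C : R, 0 <= C & forall x, rnorm (A x) ^+ 2 <= C * rnorm x ^+ 2.
Proof.
case=> _ [C CP]; exists (C ^+ 2) => [|x]; first exact: sqr_ge0.
have AC : rnorm (A x) <= C * rnorm x.
  by rewrite -(ler_real_scalar k) real_scalarM -!normE; exact: CP.
by rewrite -exprMn lerXn2r ?nnegrE ?(le_trans _ AC) ?rnorm_ge0.
Qed.

Lemma inner_adjoint_self (H : hilbertType R k) (T : H -> H) (z g : H) :
  self_adjoint T -> inner (adjoint T z) g = inner z (T g).
Proof.
move=> saT; have [|_ adjP] := xgetPex 0 (P :=
    [set m | setT m /\ forall f, setT f -> inner (T f) z = inner f m]).
  by exists (T z); split=> // f _; exact: saT.
by rewrite innerC /adjoint /adjoint_on -adjP// -innerC.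
Qed.

(** When [adjoint_on M A y] is the adjoint of [A] at [y], the inner product is
    that of [y] and [A (orth_proj M g)], and this is Young's inequality.  If no
    vector has the defining property, [adjoint_on] takes the value 0 and the
    left side vanishes.  An inequality thus covers both cases. *)
Lemma adjoint_on_young (H K : hilbertType R k) (M : closedSubspace H)
    (A : H -> K) (y : K) (g : H) (t : R) : 0 < t ->
  2 * scalar_re (inner (orth_proj M (adjoint_on M A y)) g) <=
    t * rnorm y ^+ 2 + t^-1 * rnorm (A (orth_proj M g)) ^+ 2.
Proof.
move=> t0; have [Mg gP] := orth_projP M g.
set Q := [set m | subspace_set M m /\
  forall f, subspace_set M f -> inner (A f) y = inner f m].
have [Qex|Qn] := pselect (exists m, Q m); last first.
  rewrite /adjoint_on xgetPN; last by move=> m Qm; apply: Qn; exists m.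
  rewrite orth_proj_id; last exact: subspace0.
  rewrite inner0l scalar_re0 mulr0.
  by rewrite addr_ge0// mulr_ge0 ?sqr_ge0 ?invr_ge0 ?ltW.
have [Mm mP] : Q (adjoint_on M A y) := xgetPex 0 Qex.
rewrite orth_proj_id //; set m := adjoint_on M A y in Mm mP *.
have -> : inner m g = inner y (A (orth_proj M g)).
  rewrite innerC -[g in inner g m](subrK (orth_proj M g)) innerDl gP// add0r.
  by rewrite -mP// -innerC.
exact: inner_young.
Qed.

End Operators.

(** * Energies and the frame bounds *)

Section Energy.
Variables (R : realType) (k : scalar_kind).
Variables (d : measure_display) (X : measurableType d).
Variable mu : {measure set X -> \bar R}.
Variables (H : hilbertType R k) (K : X -> hilbertType R k).
Variables (F : X -> closedSubspace H) (L : forall x, H -> K x) (v : X -> R).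

Definition energy_density (f : H) (x : X) : R :=
  v x ^+ 2 * rnorm (L x (orth_proj (F x) f)) ^+ 2.

Definition energy (f : H) : R := \int[mu]_x energy_density f x.

Lemma controlled_integrandE (A : H -> H) f x :
  controlled_integrand F L v A A f x = real_scalar (energy_density (A f) x).
Proof. by rewrite /controlled_integrand innerxx -real_scalarM. Qed.

Lemma scalar_integral_energy (A : H -> H) f :
  scalar_integral mu (controlled_integrand F L v A A f) =
  real_scalar (energy (A f)).
Proof.
rewrite /scalar_integral /energy.
under eq_Rintegral do rewrite controlled_integrandE scalar_re_real.
under [X in mk_scalar _ _ X]eq_Rintegral do
  rewrite controlled_integrandE scalar_im_real.
by rewrite Rintegral_cst// mul0r.
Qed.

Lemma scalar_integrable_energy (A : H -> H) f :
  scalar_integrable mu (controlled_integrand F L v A A f) <->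
  mu.-integrable setT (EFin \o energy_density (A f)).
Proof.
rewrite /scalar_integrable.
have -> : (fun x => (scalar_re (controlled_integrand F L v A A f x))%:E) =
    EFin \o energy_density (A f).
  by apply/funext => x /=; rewrite controlled_integrandE scalar_re_real.
have -> : (fun x => (scalar_im (controlled_integrand F L v A A f x))%:E) = cst 0%E.
  by apply/funext => x /=; rewrite controlled_integrandE scalar_im_real.
by split=> [[]//|?]; split=> //; exact: integrable0.
Qed.

(** Integrate the pointwise inequality [adjoint_on_young] with [t := B] against
    the resolution of the identity: the parameter [B] is the one that makes the
    [T]-energy term at most [rnorm f ^+ 2], half of the left side. *)
Lemma norm_le_energy (T U : H -> H) (B : R) : 0 < B -> self_adjoint T ->
    (forall f, mu.-integrable setT (EFin \o energy_density f)) ->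
    (forall f, energy (T f) <= B * rnorm f ^+ 2) ->
    resolution_of_identity mu (fun x f => real_scalar (v x ^+ 2) *:
      adjoint T (orth_proj (F x) (adjoint_on (F x) (L x)
        (L x (orth_proj (F x) (U f)))))) ->
  forall f, rnorm f ^+ 2 <= B * energy (U f).
Proof.
move=> B0 saT iE TB [_ res] f; have [[ire _] eq_f] := res f f.
move/(congr1 (@scalar_re R k)): eq_f; rewrite innerxx scalar_re_real.
rewrite /scalar_integral; set h := (fun x => scalar_re _) in ire *.
rewrite scalar_re_mk.
move=> eq_f.
have iZ (c : R) (g : X -> R) : mu.-integrable setT (EFin \o g) ->
    mu.-integrable setT (EFin \o (fun x => c * g x)).
  move=> ig; rewrite (_ : _ \o _ = (fun x => c%:E * (EFin \o g) x)%E).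
    exact: integrableZl.
  by apply/funext => x /=; rewrite EFinM.
have ih := iZ 2 h ire.
have iBU := iZ B _ (iE (U f)).
have iBT := iZ B^-1 _ (iE (T f)).
have : \int[mu]_x (2 * h x) <=
    \int[mu]_x (B * energy_density (U f) x + B^-1 * energy_density (T f) x).
  apply: le_Rintegral => // [|x _].
    exact: eq_integrable (integrableD measurableT iBU iBT).
  rewrite /h innerZl scalar_reZ inner_adjoint_self //.
  have -> : B * energy_density (U f) x + B^-1 * energy_density (T f) x =
    v x ^+ 2 * (B * rnorm (L x (orth_proj (F x) (U f))) ^+ 2 +
      B^-1 * rnorm (L x (orth_proj (F x) (T f))) ^+ 2).
    by rewrite /energy_density; ring.
  by rewrite mulrCA ler_wpM2l ?sqr_ge0// adjoint_on_young.
rewrite RintegralD// !RintegralZl// -eq_f -/(energy (U f)) -/(energy (T f)).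
have : B^-1 * energy (T f) <= rnorm f ^+ 2.
  by rewrite mulrC ler_pdivrMr// mulrC.
lra.
Qed.

End Energy.

Theorem theorem4p2 (R : realType) (k : scalar_kind)
  (d : measure_display) (X : measurableType d) (mu : {measure set X -> \bar R})
  (H : hilbertType R k) (sepH : separable_space H)
  (T U : H -> H) (hT : GBplus T) (hU : GBplus U)
  (F : X -> closedSubspace H)
  (v : X -> R) (v_ge0 : forall x, 0 <= v x) (mv : measurable_fun setT v)
  (K : X -> hilbertType R k) (L : forall x, H -> K x)
  (hL : forall x, bounded_linear_on (F x) (L x))
  (B : R) (hB : controlled_gfusion_Bessel mu F L v T T B)
  (hid : resolution_of_identity mu (fun x f =>
     real_scalar (v x ^+ 2) *:
       adjoint T (orth_proj (F x) (adjoint_on (F x) (L x)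
         (L x (orth_proj (F x) (U f))))))) :
  controlled_gfusion_frame mu F L v U U.
Proof.
case: hB => mF B0 hB; split=> //.
have [_ [saT _] [T' [bT' _ TT']]] := hT.
(* Every vector is [T (T' f)], so the Bessel hypothesis controls all energies. *)
have iE f : mu.-integrable setT (EFin \o energy_density F L v f).
  by rewrite -(TT' f); apply/scalar_integrable_energy; have [] := hB (T' f).
have TB f : energy mu F L v (T f) <= B * rnorm f ^+ 2.
  have [_] := hB f; rewrite scalar_integral_energy -inner_norm innerxx.
  by rewrite -real_scalarM ler_real_scalar.
have low := norm_le_energy B0 saT iE TB hid.
have [CU CU0 CUP] : exists2 C : R, 0 <= C &
    forall f, rnorm (U f) ^+ 2 <= C * rnorm f ^+ 2.
  by apply: bounded_operator_sqr; case: hU.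
have [CT CT0 CTP] := bounded_operator_sqr bT'.
have up f : energy mu F L v (U f) <= B * (CT * CU) * rnorm f ^+ 2.
  rewrite -(TT' (U f)); apply: (le_trans (TB _)).
  rewrite -!mulrA ler_pM2l//; apply: (le_trans (CTP _)).
  exact: ler_wpM2l.
(* Adding [B^-1] to the upper bound makes the two bounds ordered even when
   [H] is trivial. *)
exists B^-1, (B^-1 + B * (CT * CU)); split.
- by rewrite invr_gt0.
- by rewrite lerDl !mulr_ge0// ltW.
move=> f; split; first exact/scalar_integrable_energy.
rewrite scalar_integral_energy -inner_norm innerxx -!real_scalarM !ler_real_scalar.
apply/andP; split; first by rewrite mulrC ler_pdivrMr// mulrC.
apply: (le_trans (up f)); rewrite mulrDl lerDr.
by rewrite mulr_ge0 ?sqr_ge0// invr_ge0 ltW.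
Qed.
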